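(* For each integer $k\ge2$ let $\rho_\star^{k\text{-mer}}$ denote the density at which the complexity function of jammed configurations for irreversible deposition of $k$-mers attains its maximum. Then $\lim_{k\to\infty}\rho_\star^{k\text{-mer}}=1$.
   Context: A jammed configuration of length $L$ for deposition of $k$-mers is a word in $\{0,1\}^L$ whose ones are partitioned into disjoint blocks of $k$ consecutive sites (deposited $k$-mers) and in which every maximal run of zeros has length at most $k-1$. The density of a configuration with $n$ $k$-mers is $kn/L$. The complexity is $f_k(\rho)=\lim_{L\to\infty}\frac1L\ln K_{\lfloor\rho L/k\rfloor,L}$, where $K_{n,L}$ is the number of jammed configurations of length $L$ with exactly $n$ $k$-mers (set to $0$ where there are no configurations); $f_k(\rho)=\frac{\rho}{k}\big[-\ln\frac{1-z}{1-z^k}-(\frac k\rho-k)\ln z\big]$ for $\frac{k}{2k-1}<\rho\le1$, with $z\ge0$ the real root of $\sum_{i=0}^{k-1}(i+k-\frac k\rho)z^i$ maximizing this expression, and $0$ otherwise. *)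

(* Defs.v *)
From mathcomp Require Import all_boot all_order all_algebra.

Set Implicit Arguments.
Unset Strict Implicit.
Unset Printing Implicit Defensive.

(* The sites a, a+1, ..., b-1 of a lattice of length L. *)
Definition sites (L a b : nat) : {set 'I_L} := [set i : 'I_L | a <= i < b].

Definition ones (L : nat) (w : L.-tuple bool) : {set 'I_L} :=
  [set i : 'I_L | tnth w i].

Definition zeros (L : nat) (w : L.-tuple bool) : {set 'I_L} := ~: ones w.

Definition is_kmer (k L : nat) (B : {set 'I_L}) : bool :=
  [exists a : 'I_L, (a + k <= L) && (B == sites L a (a + k))].

Definition kmer_deposition (k L : nat) (w : L.-tuple bool)
    (P : {set {set 'I_L}}) : bool :=
  partition P (ones w) && [forall B in P, is_kmer k B].

Definition zero_run (L : nat) (w : L.-tuple bool) (Z : {set 'I_L}) : bool :=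
  (Z \subset zeros w) &&
  [exists a : 'I_L.+1, exists b : 'I_L.+1, Z == sites L a b].

(* If w contains no zero, the only maximal run is the empty set. *)
Definition maximal_zero_run (L : nat) (w : L.-tuple bool) (Z : {set 'I_L})
    : bool :=
  maxset (zero_run w) Z.

Definition jammed (k n L : nat) (w : L.-tuple bool) : bool :=
  [exists P : {set {set 'I_L}}, kmer_deposition k w P && (#|P| == n)] &&
  [forall Z : {set 'I_L}, maximal_zero_run w Z ==> (#|Z| <= k - 1)].

Definition num_jammed (k n L : nat) : nat :=
  #|[set w : L.-tuple bool | jammed k n w]|.

From mathcomp Require Import all_classical all_reals all_analysis.
Import Order.TTheory GRing.Theory Num.Theory.
Import numFieldNormedType.Exports.
Local Open Scope classical_set_scope.
Local Open Scope ring_scope.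

(* Where there are no configurations the term is 0, because the library sets
   ln 0 = 0. *)
Definition log_count (R : realType) (k : nat) (rho : R) (L : nat) : R :=
  ln (num_jammed k (Num.truncn (rho * L%:R / k%:R)) L)%:R / L%:R.

Definition complexity (R : realType) (k : nat) (rho : R) : R :=
  lim (log_count k rho L @[L --> \oo]).

Definition complexity_maximizers (R : realType) (k : nat) : set R :=
  [set rho : R | 0 <= rho <= 1 /\
     forall r : R, 0 <= r <= 1 -> complexity k r <= complexity k rho].
Arguments complexity_maximizers : clear implicits.

Definition rho_star (R : realType) (k : nat) : R :=
  get (complexity_maximizers R k).
Arguments rho_star : clear implicits.

(* Main.v *)
Require Import Defs.
From mathcomp Require Import all_boot all_order all_algebra.
From mathcomp Require Import zify ring lra.

(** A jammed word with n k-mers is a sequence of n+1 gaps of length < k, so the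
    number of such words of length L is a coefficient of P^(n+1), where
    P(x) = 1 + x + ... + x^(k-1).  For every x > 0 this gives the Chernoff bound
    complexity k rho <= max 0 (rate k rho x) with
    rate k rho x = rho/k ln P(x) - (1 - rho) ln x.  Let 0 < x < 1 satisfy
    x^k P(x) = 1.  Then rate k rho x = - ln x for all rho, and the derivative of
    rate k rho at x vanishes only if rho = k / (k + mu), mu being the mean of the
    law on {0, ..., k-1} proportional to x^i; so any other density has strictly
    smaller complexity.  At this density the value - ln x is attained: by Chebyshev's
    inequality for independent gaps of that law, the first gaps have a total close
    to its expectation, and an arbitrarily small proportion of remaining gaps
    adjusts the total exactly.  Finally mu <= 1/(1-x), while k x^(2k) <= 1 forces
    ln k <= 4k(1-x), hence mu/k <= 4/ln k tends to 0. *)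

(** * Jammed words as sequences of gaps *)

(** Recursion on the leftmost gap [g] and the k-mer that follows it; at [n = 0] only the last gap
    remains. This explicit list turns counting into a sum over gaps. *)
Fixpoint jammed_words (k n L : nat) : seq (seq bool) :=
  if n is n'.+1 then
    flatten [seq [seq nseq g false ++ nseq k true ++ s | s <- jammed_words k n' (L - (g + k))]
            | g <- iota 0 k & g + k <= L]
  else if L < k then [:: nseq L false] else [::].

(* The entries of A are the leftmost sites of the k-mers, in any order. *)
Definition kmers_at (k : nat) (s : seq bool) (A : seq nat) : Prop :=
  [/\ uniq A,
      {in A, forall a, a + k <= size s},
      {in A &, forall a b, a != b -> (a + k <= b) || (b + k <= a)} &
      forall i, nth false s i = has (fun a => a <= i < a + k) A].

(** Local form of jamming: no [k] consecutive sites are empty, so no further k-mer fits. *)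
Definition hits_windows (k : nat) (s : seq bool) : Prop :=
  forall a, a + k <= size s -> exists2 i, a <= i < a + k & nth false s i.

Lemma size_jammed_words k n L s : s \in jammed_words k n L -> size s = L.
Proof.
elim: n L s => [|n IHn] L s /=.
  by case: ifP => // _; rewrite inE => /eqP ->; rewrite size_nseq.
case/flattenP => t /mapP [g]; rewrite mem_filter => /andP [gL _] -> /mapP [u /IHn su ->].
by rewrite !size_cat !size_nseq su; lia.
Qed.

(** The first gap can be read off as the position of the first [true], since a nonempty k-mer
    follows it; hence different choices in the recursion give different words. *)
Lemma uniq_jammed_words k n L : 0 < k -> uniq (jammed_words k n L).
Proof.
move=> k_gt0; elim: n L => [|n IHn] L /=; first by case: ifP.
apply: allpairs_uniq_dep => [|g _|].
- exact/filter_uniq/iota_uniq.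
- exact: IHn.
move=> _ _ /allpairsPdep [g [s [_ _ ->]]] /allpairsPdep [h [t [_ _ ->]]] /= e.
have index_gap m (u : seq bool) : index true (nseq m false ++ nseq k true ++ u) = m.
  rewrite index_cat size_nseq mem_nseq andbF index_cat mem_nseq k_gt0 /=.
  by rewrite -[k](prednK k_gt0) /= addn0.
have gh : g = h by rewrite -(index_gap g s) e index_gap.
by move/eqP: e; rewrite gh !eqseq_cat // !eqxx => /eqP ->.
Qed.

Lemma nth_gap_kmer g k s i :
  nth false (nseq g false ++ nseq k true ++ s) i =
  (g <= i < g + k) || ((g + k <= i) && nth false s (i - (g + k))).
Proof.
rewrite !nth_cat !size_nseq !nth_nseq.
case: (ltnP i g) => ig; first by lia.
case: (ltnP (i - g) k) => igk; first by lia.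
rewrite -subnDA; have -> : i < g + k = false by lia.
by have -> : g + k <= i by lia.
Qed.

Lemma jammed_words_kmers k n L s : 0 < k -> s \in jammed_words k n L ->
  (exists2 A, kmers_at k s A & size A = n) /\ hits_windows k s.
Proof.
move=> k_gt0; elim: n L s => [|n IHn] L s /=.
  case: ltnP => // Lk; rewrite inE => /eqP ->; split.
    by exists [::] => //; split=> // i; rewrite nth_nseq if_same.
  by move=> a; rewrite size_nseq; lia.
case/flattenP => t /mapP [g]; rewrite mem_filter mem_iota add0n => /andP [gL gk] ->.
case/mapP => u /IHn [[A [uA sA dA nA] szA] hu] ->; split.
  exists (g :: map (addn (g + k)) A); last by rewrite /= size_map szA.
  split.
  - rewrite /= map_inj_uniq ?uA ?andbT; last exact: addnI.
    by apply/mapP => -[a _]; lia.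
  - move=> a; rewrite inE !size_cat !size_nseq => /predU1P [->|/mapP [b /sA sb ->]]; lia.
  - move=> a b; rewrite !inE.
    move=> /predU1P [->|/mapP [a' aA ->]] /predU1P [->|/mapP [b' bA ->]]; try lia.
    by rewrite eqn_add2l => /(dA _ _ aA bA); lia.
  - move=> i; rewrite nth_gap_kmer /= nA; congr (_ || _).
    rewrite has_map; case: (leqP (g + k) i) => gi /=.
      by apply: eq_has => a /=; lia.
    by apply/esym/hasPn => a _ /=; lia.
move=> a; rewrite !size_cat !size_nseq => ak.
case: (leqP (g + k) a) => ga.
  have [|i ia ui] := hu (a - (g + k)); first by lia.
  exists (i + (g + k)); first by lia.
  by rewrite nth_gap_kmer addnK ui; lia.
(* A window that starts before [g + k] meets the first k-mer at this site, because [g < k]. *)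
exists (maxn a g); first by lia.
by rewrite nth_gap_kmer; lia.
Qed.

(** Peel off the leftmost k-mer: its start [g] is the minimum of [A], and the other starts, shifted
    by [g + k], describe the rest of the word. *)
Lemma kmers_jammed_words k s A : 0 < k -> kmers_at k s A -> hits_windows k s ->
  s \in jammed_words k (size A) (size s).
Proof.
move=> k_gt0; have [n szA] := ubnP (size A).
elim: n => // n IHn in s A szA * => -[uA sA dA nA] hs.
case defA : A => [|a0 A'] /=.
  have sz : size s < k.
    case: ltnP => // ks; have [|i _] := hs 0; first by rewrite add0n.
    by rewrite nA defA.
  rewrite sz inE; apply/eqP/(@eq_from_nth _ false); first by rewrite size_nseq.
  by move=> i _; rewrite nA defA nth_nseq if_same.
have a0A : a0 \in A by rewrite defA mem_head.
have exa : exists a, a \in A by exists a0.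
case: (ex_minnP exa) => g gA gmin {exa}.
have gs := sA _ gA.
(* The window at site 0 contains a one, hence meets a k-mer starting before [k]; the leftmost one
   starts no later. *)
have gk : g < k.
  case: ltnP => // kg; have [|i ik] := hs 0; first by lia.
  by rewrite nA => /hasP [a /gmin]; lia.
pose B := [seq a - (g + k) | a <- rem g A].
have remP a : a \in rem g A -> [/\ a \in A & g + k <= a].
  rewrite mem_rem_uniq // !inE => /andP [ag aA]; split=> //.
  by have := dA _ _ aA gA ag; have := gmin _ aA; lia.
have szB : size B = size A' by rewrite size_map size_rem // defA.
apply/flattenP.
exists [seq nseq g false ++ nseq k true ++ u | u <- jammed_words k (size A') (size s - (g + k))].
  by apply/mapP; exists g => //; rewrite mem_filter mem_iota add0n gk gs.
apply/mapP; exists (drop (g + k) s); last first.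
  apply: (@eq_from_nth _ false).
    by rewrite !size_cat !size_nseq size_drop; lia.
  move=> i _; rewrite nth_gap_kmer nth_drop.
  case: (boolP (g <= i < g + k)) => gi /=.
    by rewrite nA; apply/hasP; exists g.
  case: (leqP (g + k) i) => gki /=; first by rewrite subnKC.
  by rewrite nA; apply/hasPn => a /gmin; lia.
rewrite -szB -size_drop; apply: IHn.
- by rewrite szB; move: szA; rewrite defA.
- split.
  + rewrite map_inj_in_uniq ?rem_uniq // => a b /remP [_ ga] /remP [_ gb]; lia.
  + by move=> _ /mapP [a /remP [/sA sa ga] ->]; rewrite size_drop; lia.
  + move=> _ _ /mapP [a /remP [aA ga] ->] /mapP [b /remP [bA gb] ->] ab.
    by have := dA _ _ aA bA; lia.
  + move=> i; rewrite nth_drop nA has_map.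
    apply/hasP/hasP => [] [a aA ai].
      exists a => /=; last by lia.
      by rewrite mem_rem_uniq // !inE aA andbT; apply/eqP => ag; lia.
    by have [aA' ga] := remP _ aA; exists a => //; move: ai => /=; lia.
- move=> a; rewrite size_drop => ak.
  have [|i ia si] := hs (g + k + a); first by lia.
  exists (i - (g + k)); first by lia.
  by rewrite nth_drop subnKC //; lia.
Qed.

(** * Agreement of the list of words with the definition by sets of sites *)

Lemma in_sites L a b (i : 'I_L) : (i \in sites L a b) = (a <= i < b).
Proof. by rewrite inE. Qed.

Lemma card_sites L a b : b <= L -> #|sites L a b| = b - a.
Proof.
move=> bL; rewrite cardE -(size_map val) -(size_iota a (b - a)).
apply/perm_size/uniq_perm; rewrite ?iota_uniq //.
  by rewrite map_inj_uniq ?enum_uniq //; exact: val_inj.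
move=> i; rewrite mem_iota; apply/mapP/idP => [[j]|iab].
  by rewrite mem_enum in_sites => jab -> /=; lia.
have iL : i < L by lia.
by exists (Ordinal iL); rewrite // mem_enum in_sites /=; lia.
Qed.

Lemma sites_inj k L a b : 0 < k -> a + k <= L -> b + k <= L ->
  sites L a (a + k) = sites L b (b + k) -> a = b.
Proof.
move=> k_gt0 aL bL /setP e.
have aL' : a < L by lia.
have bL' : b < L by lia.
have := e (Ordinal aL'); have := e (Ordinal bL').
by rewrite !in_sites /=; lia.
Qed.

Lemma sites_sub_zeros L (w : L.-tuple bool) a b :
  (sites L a b \subset zeros w) =
  ~~ has (fun i => (a <= i < b) && nth false w i) (iota 0 L).
Proof.
apply/subsetP/hasPn => [sub i|none i].
  rewrite mem_iota add0n => iL; apply/negP => /andP [iab wi].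
  have := sub (Ordinal iL); rewrite in_sites /= => /(_ iab).
  by rewrite !inE (tnth_nth false) /= wi.
rewrite in_sites => iab; rewrite !inE (tnth_nth false).
by have := none i; rewrite mem_iota add0n ltn_ord iab => /(_ isT).
Qed.

(** A window of [k] zeros extends to a maximal zero run with at least [k] sites; conversely, a run
    of more than [k - 1] sites begins with such a window. *)
Lemma maximal_zero_runsP k L (w : L.-tuple bool) : 0 < k ->
  [forall Z, maximal_zero_run w Z ==> (#|Z| <= k - 1)] <-> hits_windows k w.
Proof.
move=> k_gt0; split=> [/forallP short a|hits].
  rewrite size_tuple => ak.
  case: (boolP (sites L a (a + k) \subset zeros w)) => [sub|]; last first.
    by rewrite sites_sub_zeros negbK => /hasP [i _ /andP [? ?]]; exists i.
  have run : zero_run w (sites L a (a + k)).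
    rewrite /zero_run sub /=.
    have aL : a < L.+1 by lia.
    by apply/existsP; exists (Ordinal aL); apply/existsP; exists (Ordinal (ak : a + k < L.+1)).
  have [Z maxZ subZ] := maxset_exists run.
  have /implyP /(_ maxZ) := short Z.
  have := subset_leq_card subZ; rewrite card_sites //; lia.
apply/forallP => Z; apply/implyP => /maxsetp /andP [].
move=> sub /existsP [a /existsP [b /eqP eZ]].
rewrite eZ card_sites; last by rewrite -ltnS ltn_ord.
rewrite leqNgt; apply/negP => ba.
have := hits a; rewrite size_tuple; case; first by have := ltn_ord b; lia.
move=> i iab wi; move: sub; rewrite eZ sites_sub_zeros => /hasP []; exists i.
  by rewrite mem_iota; have := ltn_ord b; lia.
by rewrite wi; lia.
Qed.

(** A k-mer is determined by its leftmost site, so the blocks of [P] and the entries of [A]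
    correspond one to one. *)
Lemma kmer_depositionP k n L (w : L.-tuple bool) : 0 < k ->
  [exists P : {set {set 'I_L}}, kmer_deposition k w P && (#|P| == n)] <->
  (exists2 A, kmers_at k w A & size A = n).
Proof.
move=> k_gt0; split.
  case/existsP => P /andP [/andP [partP /forallP kmerP] /eqP cardP].
  have [covP trivP P0] : [/\ cover P = ones w, trivIset P & set0 \notin P] by case/and3P: partP => /eqP.
  pose A := [seq val a | a : 'I_L <- enum [set a : 'I_L | (a + k <= L) && (sites L a (a + k) \in P)]].
  have AP a : a \in A -> a + k <= L /\ sites L a (a + k) \in P.
    by case/mapP => b; rewrite mem_enum inE => /andP [? ?] ->.
  have PA a : a + k <= L -> sites L a (a + k) \in P -> a \in A.
    move=> aL aP; have aL' : a < L by lia.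
    by apply/mapP; exists (Ordinal aL'); rewrite // mem_enum inE aL aP.
  exists A; last first.
    rewrite size_map -cardE -cardP.
    rewrite -(@card_in_imset _ _ (fun a : 'I_L => sites L a (a + k))).
      congr #|pred_of_set _|; apply/setP => B; apply/imsetP/idP => [[a]|BP].
        by rewrite inE => /andP [_ ?] ->.
      have /implyP /(_ BP) /existsP [a /andP [aL /eqP eB]] := kmerP B.
      by exists a => //; rewrite inE aL -eB.
    move=> a b; rewrite !inE => /andP [aL _] /andP [bL _] e.
    by apply: val_inj; apply: sites_inj e.
  split.
  - by rewrite map_inj_uniq ?enum_uniq //; exact: val_inj.
  - by move=> a /AP []; rewrite size_tuple.
  - move=> a b /AP [aL aP] /AP [bL bP] ab.
    case: (eqVneq (sites L a (a + k)) (sites L b (b + k))) => [|neq].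
      by move/(sites_inj _ _ _ _ k_gt0 aL bL)/eqP; rewrite (negPf ab).
    have := trivIsetP trivP _ _ aP bP neq; rewrite -setI_eq0 => /eqP /setP dis.
    (* Overlapping k-mers would share the later of their two starts. *)
    have mL : maxn a b < L by lia.
    by have := dis (Ordinal mL); rewrite in_setI !in_sites inE /=; lia.
  - move=> i; case: (ltnP i L) => iL; last first.
      rewrite nth_default ?size_tuple //.
      by apply/esym/hasPn => a /AP [aL _]; lia.
    have -> : nth false w i = (Ordinal iL \in ones w) by rewrite inE (tnth_nth false).
    rewrite -covP; apply/bigcupP/hasP => [[B BP]|[a /AP [aL aP] ai]].
      have /implyP /(_ BP) /existsP [a /andP [aL /eqP eB]] := kmerP B.
      rewrite eB in_sites => ai; exists (val a) => //.
      by apply: PA => //; rewrite -eB.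
    by exists (sites L a (a + k)); rewrite // in_sites.
case=> A [uA sA dA nA] szA.
have sA' a : a \in A -> a + k <= L by move/sA; rewrite size_tuple.
pose D : {set 'I_L} := [set a : 'I_L | val a \in A].
pose P : {set {set 'I_L}} := [set sites L a (a + k) | a : 'I_L in D].
have PP B : B \in P -> exists2 a : nat, a \in A & B = sites L a (a + k).
  by case/imsetP => a; rewrite inE => ? ->; exists (val a).
apply/existsP; exists P; apply/andP; split; last first.
  rewrite card_in_imset; last first.
    move=> a b; rewrite !inE => /sA' aL /sA' bL e.
    by apply: val_inj; apply: sites_inj e.
  rewrite -szA cardE -(size_map val); apply/eqP/perm_size/uniq_perm => //.
    by rewrite map_inj_uniq ?enum_uniq //; exact: val_inj.
  move=> a; apply/mapP/idP => [[b]|aA].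
    by rewrite mem_enum inE => ? ->.
  have aL : a < L by have := sA' _ aA; lia.
  by exists (Ordinal aL); rewrite // mem_enum inE.
apply/andP; split; last first.
  apply/forallP => B; apply/implyP => /imsetP [a]; rewrite inE => /sA' aL ->.
  by apply/existsP; exists a; rewrite aL /=.
apply/and3P; split.
- apply/eqP/setP => i; rewrite inE (tnth_nth false) nA.
  apply/bigcupP/hasP => [[B /PP [a aA ->]]|[a aA ai]].
    by rewrite in_sites => ai; exists a.
  have aL : a < L by have := sA' _ aA; lia.
  exists (sites L a (a + k)); last by rewrite in_sites.
  by apply/imsetP; exists (Ordinal aL); rewrite ?inE.
- apply/trivIsetP => _ _ /PP [a aA ->] /PP [b bA ->] neq.
  have /(dA _ _ aA bA) ab : a != b by apply: contraNneq neq => ->.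
  rewrite -setI_eq0; apply/eqP/setP => i; rewrite in_setI !in_sites inE; lia.
- apply/negP => /PP [a /sA' aL /setP e].
  have aL' : a < L by lia.
  by have := e (Ordinal aL'); rewrite inE in_sites /=; lia.
Qed.

Lemma jammedP k n L (w : L.-tuple bool) : 0 < k ->
  jammed k n w = (val w \in jammed_words k n L).
Proof.
move=> k_gt0; apply/andP/idP => [[]|/(jammed_words_kmers _ _ _ _ k_gt0) [wA hw]].
  move=> /(kmer_depositionP _ _ _ _ k_gt0) [A kA <-] /(maximal_zero_runsP _ _ _ k_gt0) hw.
  by have := kmers_jammed_words _ _ _ k_gt0 kA hw; rewrite size_tuple.
by split; [apply/kmer_depositionP|apply/maximal_zero_runsP].
Qed.

Lemma num_jammedE k n L : 0 < k -> num_jammed k n L = size (jammed_words k n L).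
Proof.
move=> k_gt0; rewrite /num_jammed cardE -(size_map val); apply/perm_size/uniq_perm.
- by rewrite map_inj_uniq ?enum_uniq //; exact: val_inj.
- exact: uniq_jammed_words.
move=> s; apply/mapP/idP => [[w]|sJ].
  by rewrite mem_enum inE jammedP // => ? ->.
have /eqP sL := size_jammed_words _ _ _ _ sJ.
by exists (Tuple sL); rewrite // mem_enum inE jammedP.
Qed.

(** * Weighted sums over sequences of gaps *)

Import Order.TTheory GRing.Theory Num.Theory.
Local Open Scope ring_scope.

(* The sum of phi (g_1 + ... + g_N) over all sequences of gaps g_i < k. *)
Fixpoint gap_sum {R : realFieldType} (k N : nat) (phi : nat -> R) : R :=
  if N is N'.+1 then \sum_(i < k) gap_sum k N' (fun j => phi (i + j)%N) else phi 0%N.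

Definition gap_gf {R : realFieldType} (k : nat) (x : R) : R := \sum_(i < k) x ^+ i.

Definition gap_mean {R : realFieldType} (k : nat) (x : R) : R :=
  (\sum_(i < k) i%:R * x ^+ i) / gap_gf k x.

Lemma gap_sumS (R : realFieldType) k N (phi : nat -> R) :
  gap_sum k N.+1 phi = \sum_(i < k) gap_sum k N (fun j => phi (i + j)%N).
Proof. by []. Qed.

Lemma eq_gap_sum (R : realFieldType) k N (phi psi : nat -> R) :
  phi =1 psi -> gap_sum k N phi = gap_sum k N psi.
Proof.
elim: N phi psi => [|N IHN] phi psi e /=; first exact: e.
by apply: eq_bigr => i _; apply: IHN => j; exact: e.
Qed.

Lemma ler_gap_sum (R : realFieldType) k N (phi psi : nat -> R) :
  (forall j, phi j <= psi j) -> gap_sum k N phi <= gap_sum k N psi.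
Proof.
elim: N phi psi => [|N IHN] phi psi e /=; first exact: e.
by apply: ler_sum => i _; apply: IHN => j; exact: e.
Qed.

Lemma gap_sum_ge0 (R : realFieldType) k N (phi : nat -> R) :
  (forall j, 0 <= phi j) -> 0 <= gap_sum k N phi.
Proof.
elim: N phi => [|N IHN] phi phi_ge0 //=.
by apply: sumr_ge0 => i _; apply: IHN.
Qed.

Lemma gap_sumZ (R : realFieldType) k N (a : R) (phi : nat -> R) :
  gap_sum k N (fun j => a * phi j) = a * gap_sum k N phi.
Proof.
elim: N phi => //= N IHN phi.
by rewrite mulr_sumr; apply: eq_bigr => i _; rewrite IHN.
Qed.

Lemma gap_sumB (R : realFieldType) k N (phi psi : nat -> R) :
  gap_sum k N (fun j => phi j - psi j) = gap_sum k N phi - gap_sum k N psi.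
Proof.
elim: N phi psi => //= N IHN phi psi.
by rewrite -sumrB; apply: eq_bigr => i _; rewrite IHN.
Qed.

Lemma gap_sumD (R : realFieldType) k N s (phi : nat -> R) :
  gap_sum k (N + s) phi = gap_sum k N (fun j => gap_sum k s (fun l => phi (j + l)%N)).
Proof.
elim: N phi => //= N IHN phi; apply: eq_bigr => i _; rewrite IHN.
by apply: eq_gap_sum => j; apply: eq_gap_sum => l; rewrite addnA.
Qed.

Lemma gap_sum_expr (R : realFieldType) k N (x : R) :
  gap_sum k N (fun j => x ^+ j) = gap_gf k x ^+ N.
Proof.
elim: N => [|N IHN] /=; first by rewrite !expr0.
rewrite exprS /gap_gf mulr_suml; apply: eq_bigr => i _.
by rewrite -IHN -gap_sumZ; apply: eq_gap_sum => j; rewrite exprD.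
Qed.

Lemma gap_gf_gt0 (R : realFieldType) k (x : R) : (0 < k)%N -> 0 < x -> 0 < gap_gf k x.
Proof.
case: k => // k _ x_gt0; rewrite /gap_gf big_ord_recl expr0 ltr_pwDl //.
by apply: sumr_ge0 => i _; rewrite exprn_ge0 // ltW.
Qed.

(** * Moments of the gap law *)

Definition gap_var {R : realFieldType} (k : nat) (x : R) : R :=
  (\sum_(i < k) i%:R ^+ 2 * x ^+ i) / gap_gf k x - gap_mean k x ^+ 2.

(** Unnormalized second moment about [a] of the total of [N] independent gaps: variance plus squared
    bias. The centre [a] varies in the induction, because a first gap [i] moves it to [a - i]. *)
Lemma gap_sum_var (R : realFieldType) k N (x a : R) : (0 < k)%N -> 0 < x ->
  gap_sum k N (fun j => x ^+ j * (j%:R - a) ^+ 2) =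
  gap_gf k x ^+ N * (N%:R * gap_var k x + (N%:R * gap_mean k x - a) ^+ 2).
Proof.
move=> k_gt0 x_gt0; have /lt0r_neq0 P0 := gap_gf_gt0 _ _ _ k_gt0 x_gt0.
elim: N a => [|N IHN] a /=; first by rewrite !expr0; ring.
pose b := N%:R * gap_mean k x - a.
transitivity (gap_gf k x ^+ N * \sum_(i < k)
    (x ^+ i * (N%:R * gap_var k x + b ^+ 2) + (i%:R * x ^+ i) * (2 * b) + i%:R ^+ 2 * x ^+ i)).
  rewrite mulr_sumr; apply: eq_bigr => i _.
  rewrite (eq_gap_sum _ _ _ _ (fun j => x ^+ i * (x ^+ j * (j%:R - (a - i%:R)) ^+ 2))).
    by rewrite gap_sumZ IHN /b; ring.
  by move=> j; rewrite exprD natrD; ring.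
rewrite !big_split /= -!mulr_suml -/(gap_gf k x).
have -> : \sum_(i < k) i%:R * x ^+ i = gap_gf k x * gap_mean k x.
  by rewrite /gap_mean mulrC divfK.
have -> : \sum_(i < k) i%:R ^+ 2 * x ^+ i = gap_gf k x * (gap_var k x + gap_mean k x ^+ 2).
  by rewrite /gap_var subrK mulrC divfK.
by rewrite /b [_ ^+ N.+1]exprS -[N.+1%:R]natr1; ring.
Qed.

Lemma gap_var_le (R : realFieldType) k (x : R) : (0 < k)%N -> 0 < x ->
  gap_var k x <= k%:R ^+ 2.
Proof.
move=> k_gt0 x_gt0; have P_gt0 := gap_gf_gt0 _ _ _ k_gt0 x_gt0.
apply: (@le_trans _ _ ((\sum_(i < k) i%:R ^+ 2 * x ^+ i) / gap_gf k x)).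
  by rewrite /gap_var lerBlDr lerDl sqr_ge0.
rewrite ler_pdivrMr // mulr_sumr; apply: ler_sum => i _.
rewrite ler_wpM2r ?exprn_ge0 ?(ltW x_gt0) // lerXn2r ?nnegrE ?ler_nat //.
exact: ltnW.
Qed.

(** Strictness here and in the upper bound [k - 1] below leaves room to move a total of gaps away
    from its expectation in both directions. *)
Lemma gap_mean_gt0 (R : realFieldType) k (x : R) : (1 < k)%N -> 0 < x -> 0 < gap_mean k x.
Proof.
move=> k_gt1 x_gt0; have P_gt0 := gap_gf_gt0 _ _ _ (ltnW k_gt1) x_gt0.
rewrite divr_gt0 //; case: k k_gt1 {P_gt0} => [//|[//|k]] _.
rewrite !big_ord_recl mul0r add0r ltr_pwDl ?expr1 ?mul1r //.
by apply: sumr_ge0 => i _; rewrite mulr_ge0 ?exprn_ge0 // ltW.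
Qed.

Lemma gap_mean_lt (R : realFieldType) k (x : R) : (1 < k)%N -> 0 < x ->
  gap_mean k x < k%:R - 1.
Proof.
move=> k_gt1 x_gt0; have P_gt0 := gap_gf_gt0 _ _ _ (ltnW k_gt1) x_gt0.
rewrite ltr_pdivrMr // mulr_sumr.
case: k k_gt1 {P_gt0} => [//|[//|k]] _.
rewrite -[k.+2%:R]natr1 addrK big_ord_recl [ltRHS]big_ord_recl.
rewrite mul0r add0r expr0 mulr1 ltr_pwDl ?ltr0n //.
apply: ler_sum => i _; rewrite ler_wpM2r ?exprn_ge0 ?(ltW x_gt0) // ler_nat.
exact: ltn_ord i.
Qed.

(** * Bounds on the number of gap sequences with a given total *)

Lemma gap_sum_pred1_ge1 (R : realFieldType) k N m : (0 < k)%N -> (m <= N * (k - 1))%N ->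
  1 <= gap_sum k N (fun j => (j == m)%:R : R).
Proof.
move=> k_gt0; elim: N m => [|N IHN] m /=.
  by rewrite mul0n leqn0 => /eqP ->; rewrite eqxx.
(* Greedy choice: the first gap takes as much of [m] as it can hold. *)
rewrite mulSn => mN; have ik : (minn m (k - 1) < k)%N by lia.
rewrite (bigD1 (Ordinal ik)) //= ler_wpDr //.
  by apply: sumr_ge0 => i _; apply: gap_sum_ge0.
apply: (le_trans (IHN (m - minn m (k - 1))%N _)).
  by rewrite minnE subKn ?leq_subr // leq_subLR.
by apply: ler_gap_sum => j; rewrite ler_nat; case: eqP => // ->; rewrite subnKC ?eqxx // geq_minl.
Qed.

(** The [n] k-mers occupy [k * n] sites and separate [n + 1] gaps, which share the remaining
    sites. *)
Lemma size_jammed_wordsE (R : realFieldType) k n L : (0 < k)%N ->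
  (size (jammed_words k n L))%:R =
  gap_sum k n.+1 (fun j => (j + k * n == L)%N%:R : R).
Proof.
move=> k_gt0; elim: n L => [|n IHn] L.
  rewrite /=; under eq_bigr => i _ do rewrite muln0 !addn0.
  case: ltnP => [Lk|kL] /=.
    rewrite (bigD1 (Ordinal Lk)) //= eqxx big1 ?addr0 // => i.
    by rewrite -val_eqE /= => /negPf ->.
  by rewrite big1 // => i _; have := ltn_ord i; case: eqP => //; lia.
have -> : gap_sum k n.+2 (fun j => (j + k * n.+1 == L)%N%:R : R) =
   \sum_(i < k) (if (i + k <= L)%N then (size (jammed_words k n (L - (i + k))))%:R else 0).
  rewrite gap_sumS; apply: eq_bigr => i _; case: leqP => iL.
    by rewrite IHn; apply: eq_gap_sum => j; congr ((nat_of_bool _)%:R); lia.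
  rewrite -[RHS](mul0r (gap_sum k n.+1 (fun=> 0))) -gap_sumZ.
  by apply: eq_gap_sum => j; rewrite mul0r; case: eqP => //; lia.
rewrite /= size_flatten /shape -map_comp sumnE big_map big_filter natr_sum.
rewrite -[in RHS](big_mkord xpredT (fun i => if (i + k <= L)%N then
  (size (jammed_words k n (L - (i + k))))%:R else 0)) /index_iota subn0.
rewrite big_mkcond; apply: eq_bigr => i _.
by case: ifP => //= _; rewrite size_map.
Qed.

(** Chernoff bound: the indicator of [j + k * n = L], multiplied by [x ^+ L], is at most
    [x ^+ (k * n) * x ^+ j]. *)
Lemma size_jammed_words_le (R : realFieldType) k n L (x : R) : (0 < k)%N -> 0 < x ->
  (size (jammed_words k n L))%:R * x ^+ L <= x ^+ (k * n) * gap_gf k x ^+ n.+1.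
Proof.
move=> k_gt0 x_gt0; rewrite size_jammed_wordsE // -gap_sum_expr mulrC -!gap_sumZ.
apply: ler_gap_sum => j; case: eqP => [<-|_]; first by rewrite mulr1 addnC exprD.
by rewrite mulr0 mulr_ge0 // exprn_ge0 // ltW.
Qed.

(* Chebyshev's inequality controls the sum of the first N gaps; the last s
   gaps then adjust the total to exactly m. *)
Lemma gap_sum_pred1_ge (R : realFieldType) k N s m (x D : R) :
  (0 < k)%N -> 0 < x <= 1 -> 0 < D -> 2 * N%:R * k%:R ^+ 2 <= D ^+ 2 ->
  m%:R - (s * (k - 1))%:R <= N%:R * gap_mean k x - D ->
  N%:R * gap_mean k x + D <= m%:R ->
  gap_gf k x ^+ N / 2 <= x ^+ (m - s * (k - 1)) * gap_sum k (N + s) (fun j => (j == m)%:R).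
Proof.
move=> k_gt0 /andP [x_gt0 x_le1] D_gt0 ND mD Dm.
have P_gt0 := gap_gf_gt0 _ _ _ k_gt0 x_gt0.
rewrite gap_sumD -gap_sumZ.
(* The factor of [x ^+ j], one minus the squared deviation over [D ^+ 2], bounds from below the
   indicator of a deviation smaller than [D]. *)
apply: (@le_trans _ _ (gap_sum k N (fun j =>
    x ^+ j - D ^- 2 * (x ^+ j * (j%:R - N%:R * gap_mean k x) ^+ 2)))).
  rewrite gap_sumB gap_sumZ gap_sum_expr gap_sum_var // subrr expr0n /= addr0.
  rewrite mulrCA -[X in _ <= X - _]mulr1 -mulrBr ler_pM2l ?exprn_gt0 //.
  rewrite lerBrDr -lerBrDl mulrC ler_pdivrMr ?exprn_gt0 //.
  (* It remains that [N] times the variance is at most [D ^+ 2 / 2]. *)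
  have := gap_var_le R k x k_gt0 x_gt0.
  move/(ler_wpM2l (ler0n R N)); lra.
apply: ler_gap_sum => j.
have S_ge0 : 0 <= gap_sum k s (fun l => (j + l == m)%N%:R : R) by apply: gap_sum_ge0.
case: (lerP D `|j%:R - N%:R * gap_mean k x|) => far.
  apply: (@le_trans _ _ 0); last by rewrite mulr_ge0 // exprn_ge0 // ltW.
  rewrite subr_le0 mulrCA ler_peMr ?exprn_ge0 ?(ltW x_gt0) //.
  rewrite mulrC ler_pdivlMr ?exprn_gt0 // mul1r -[leRHS]real_normK ?num_real //.
  by rewrite lerXn2r ?nnegrE ?(ltW D_gt0).
move: far; rewrite ltr_distl => /andP [lo hi].
have jm : (j <= m)%N by rewrite -(ler_nat R); lra.
have mj : (m <= j + s * (k - 1))%N by rewrite -(ler_nat R) natrD; lra.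
apply: (@le_trans _ _ (x ^+ j)).
  rewrite gerBl; apply: mulr_ge0; first by rewrite invr_ge0 exprn_ge0 ?(ltW D_gt0).
  by rewrite mulr_ge0 ?sqr_ge0 ?exprn_ge0 ?(ltW x_gt0).
apply: (@le_trans _ _ (x ^+ (m - s * (k - 1)) * 1)).
  (* Since [x <= 1], the smallest possible exponent [m - s * (k - 1)] gives the largest weight. *)
  by rewrite mulr1; apply: ler_wiXn2l => //; [exact: ltW|rewrite leq_subLR addnC].
rewrite ler_wpM2l ?exprn_ge0 ?(ltW x_gt0) //.
apply: (le_trans (gap_sum_pred1_ge1 R k s (m - j) k_gt0 _)); first by rewrite leq_subLR.
by apply: ler_gap_sum => l; rewrite ler_nat; case: eqP => // ->; rewrite subnKC ?eqxx.
Qed.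

(** * The critical weight *)

From mathcomp Require Import all_classical all_reals all_analysis.
Import numFieldNormedType.Exports.
Local Open Scope classical_set_scope.

(** The weights [x ^+ (i + k)] of a gap [i] followed by a k-mer sum to 1. *)
Definition critical_weight {R : realType} (k : nat) (x : R) : Prop :=
  0 < x < 1 /\ x ^+ k * gap_gf k x = 1.

Lemma gap_gf_horner (R : realFieldType) k (x : R) :
  gap_gf k x = (\poly_(i < k) 1 : {poly R}).[x].
Proof. by rewrite horner_poly; apply: eq_bigr => i _; rewrite mul1r. Qed.

(** Intermediate values: the polynomial is [-1] at 0 and [k - 1 > 0] at 1. *)
Lemma exists_critical_weight (R : realType) k : (1 < k)%N ->
  exists x : R, critical_weight k x.
Proof.
move=> k_gt1; pose p : {poly R} := 'X^k * \poly_(i < k) 1 - 1.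
have pE x : p.[x] = x ^+ k * gap_gf k x - 1 by rewrite !hornerE -gap_gf_horner.
have gf1 : gap_gf k (1 : R) = k%:R.
  by rewrite /gap_gf; under eq_bigr do rewrite expr1n; rewrite sumr_const card_ord.
have p0 : p.[0] = - 1 by rewrite pE expr0n gtn_eqF ?(ltnW k_gt1) // mul0r sub0r.
have p1 : 0 < p.[1] by rewrite pE expr1n mul1r gf1 subr_gt0 ltr1n.
have [||x /andP [x0 x1] /rootP px] := @poly_ivt R p 0 1; first by [].
  by rewrite p0 lerN10 ltW.
exists x; split; last by apply/eqP; rewrite -subr_eq0 -pE px.
rewrite !lt_neqAle x0 x1 !andbT; apply/andP; split.
  by apply: contra_eq_neq px => <-; rewrite p0 oppr_eq0 oner_eq0.
by apply: contra_eq_neq px => ->; rewrite gt_eqF.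
Qed.

(** Multiplying the sum of the [i x^i] by [1 - x] makes it telescope to [x P(x) - k x^k], which is
    at most [P(x)]. *)
Lemma gap_mean_le (R : realFieldType) k (x : R) : 0 < x < 1 -> (0 < k)%N ->
  gap_mean k x <= (1 - x)^-1.
Proof.
move=> /andP [x_gt0 x_lt1] k_gt0; have P_gt0 := gap_gf_gt0 _ _ _ k_gt0 x_gt0.
have sumE : (1 - x) * (\sum_(i < k) i%:R * x ^+ i) = x * gap_gf k x - k%:R * x ^+ k.
  rewrite /gap_gf; elim: (k) => [|m IHm]; first by rewrite !big_ord0 expr0; ring.
  by rewrite !big_ord_recr /= !mulrDr IHm [x ^+ m.+1]exprS -[m.+1%:R]natr1; ring.
rewrite ler_pdivrMr // mulrC ler_pdivlMr ?subr_gt0 // mulrC sumE.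
have : 0 <= k%:R * x ^+ k by rewrite mulr_ge0 ?exprn_ge0 ?(ltW x_gt0).
have : x * gap_gf k x <= 1 * gap_gf k x by rewrite ler_wpM2r ?ltW.
lra.
Qed.

Lemma ln_le_critical_weight (R : realType) k (x : R) : (1 < k)%N -> critical_weight k x ->
  ln k%:R <= 4 * (k%:R * (1 - x)).
Proof.
move=> k_gt1 [/andP [x_gt0 x_lt1] Px].
(* Otherwise [P(x) <= 2] and [x^k <= x^2 <= 1/4], so the product could not be 1. *)
have x_half : 2^-1 < x.
  rewrite ltNge; apply/negP => x_half.
  have P_le2 : gap_gf k x <= 2.
    have : (1 - x) * gap_gf k x <= 1.
      rewrite -[1 - x]opprB mulNr -subrX1 opprB gerBl exprn_ge0 // ltW //.
    have : 2^-1 * gap_gf k x <= (1 - x) * gap_gf k x.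
      rewrite ler_wpM2r //; last by lra.
      by rewrite ltW // gap_gf_gt0 // ltnW.
    lra.
  have xk : x ^+ k <= x ^+ 2 by apply: ler_wiXn2l => //; exact: ltW.
  have : x ^+ k * gap_gf k x <= x ^+ 2 * 2.
    by apply: ler_pM => //; rewrite ?exprn_ge0 ?ltW // gap_gf_gt0 // ltnW.
  have : x ^+ 2 <= 2^-1 * 2^-1 by apply: ler_pM => //; exact: ltW.
  rewrite Px; lra.
have k_gt0 : 0 < k%:R :> R by rewrite ltr0n ltnW.
(* Each of the [k] terms of [P(x)] is at least [x^k]. *)
have kx : k%:R * x ^+ (k + k) <= 1.
  rewrite exprD mulrA -[leRHS]Px [leRHS]mulrC ler_wpM2r ?exprn_ge0 ?(ltW x_gt0) //.
  have -> : k%:R * x ^+ k = \sum_(i < k) x ^+ k by rewrite sumr_const card_ord mulr_natl.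
  apply: ler_sum => i _.
  by apply: ler_wiXn2l; [exact: ltW|exact: ltW|exact: ltnW (ltn_ord i)].
have := ln_le0 kx; rewrite lnM ?posrE ?exprn_gt0 // lnXn // mulrnDr -![ln x *+ _]mulr_natl => ln_k.
have : ln x^-1 <= x^-1 - 1.
  by rewrite -[x^-1 in leLHS](subrKC 1) le_ln1Dx // ltrBrDr addNr invr_gt0.
rewrite lnV ?posrE // => ln_x.
have ix : x^-1 - 1 <= 2 * (1 - x).
  rewrite -(ler_pM2r x_gt0) mulrBl mulVf ?gt_eqF // mul1r.
  have : 0 <= (1 - x) * (2 * x - 1) by rewrite mulr_ge0 //; lra.
  lra.
have : k%:R * (- ln x) <= k%:R * (2 * (1 - x)).
  by rewrite ler_pM2l // (le_trans ln_x).
lra.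
Qed.

(** * The Chernoff exponent and its stationary point *)

Definition rate {R : realType} (k : nat) (rho x : R) : R :=
  rho / k%:R * ln (gap_gf k x) - (1 - rho) * ln x.

Lemma rate_critical_weight (R : realType) k (rho x : R) : (0 < k)%N ->
  critical_weight k x -> rate k rho x = - ln x.
Proof.
move=> k_gt0 [/andP [x_gt0 _] Px].
have k0 : k%:R != 0 :> R by rewrite pnatr_eq0 gtn_eqF.
rewrite /rate; have -> : gap_gf k x = x ^- k by rewrite -[RHS]mulr1 -Px mulKf // expf_neq0 // gt_eqF.
rewrite lnV ?posrE ?exprn_gt0 // lnXn // -[ln x *+ _]mulr_natl; field; exact: k0.
Qed.

Definition critical_density {R : realType} (k : nat) (x : R) : R :=
  k%:R / (k%:R + gap_mean k x).

(** If no weight improved on [x], then [x] would minimize the rate over the positive reals. The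
    vanishing derivative then reads [rho * (k + gap_mean k x) = k], so [rho] would be the critical
    density. *)
Lemma rate_noncritical (R : realType) k (rho x : R) : (0 < k)%N -> 0 < x ->
  rho != critical_density k x -> exists2 y : R, 0 < y & rate k rho y < rate k rho x.
Proof.
move=> k_gt0 x_gt0 rho_x; apply: contrapT => no_y.
have P_gt0 (y : R) : 0 < y -> 0 < gap_gf k y by apply: gap_gf_gt0.
pose q : {poly R} := \poly_(i < k) 1.
have dP (y : R) : 0 < y -> is_derive y 1 (rate k rho)
    (rho / k%:R * ((gap_gf k y)^-1 * (deriv q).[y]) - (1 - rho) * y^-1).
  move=> y_gt0.
  have d1 : is_derive y 1 (@ln R \o horner q) ((gap_gf k y)^-1 * (deriv q).[y]).
    apply: is_derive1_comp; rewrite -gap_gf_horner; apply: is_derive1_ln; exact: P_gt0.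
  have d2 := is_derive1_ln y_gt0.
  have := is_deriveB (is_deriveZ (rho / k%:R) d1) (is_deriveZ (1 - rho) d2).
  suff -> : (rho / k%:R \*: (@ln R \o horner q)) - ((1 - rho) \*: @ln R) = rate k rho by [].
  by apply/funext => z; rewrite /rate gap_gf_horner.
have : is_derive x 1 (rate k rho) 0.
  apply: (@derive1_at_min R (rate k rho) 0 (x + 1)).
  - by rewrite addr_ge0 // ltW.
  - by move=> t; rewrite in_itv /= => /andP [t_gt0 _]; case: (dP t t_gt0).
  - by rewrite in_itv /= x_gt0 ltrDl ltr01.
  - move=> t; rewrite in_itv /= => /andP [t_gt0 _]; rewrite leNgt; apply/negP => lt_t.
    by apply: no_y; exists t.
case=> _ v0; case: (dP x x_gt0) => _; rewrite {}v0 => /esym d0.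
(* The mean of the gap law is [x P'(x) / P(x)]. *)
have meanE : gap_mean k x = x * ((gap_gf k x)^-1 * (deriv q).[x]).
  rewrite /gap_mean mulrCA mulrC; congr (_ * _).
  rewrite (horner_coef_wide _ (_ : size (deriv q) <= k)%N); last first.
    by rewrite (leq_trans (size_poly _ _)) // (leq_trans (leq_pred _)) // size_poly.
  rewrite mulr_sumr; case: k k_gt0 @q {rho_x no_y P_gt0 dP d0} => // k _ q.
  rewrite big_ord_recl mul0r add0r big_ord_recr /=.
  rewrite coef_deriv coef_poly ltnn mul0rn mul0r mulr0 addr0.
  apply: eq_bigr => i _; rewrite coef_deriv coef_poly /= /bump /= add1n ltnS ltn_ord exprS.
  by ring.
have k0 : 0 < k%:R :> R by rewrite ltr0n.
have m_ge0 : 0 <= gap_mean k x.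
  rewrite divr_ge0 ?(ltW (P_gt0 _ x_gt0)) //; apply: sumr_ge0 => i _.
  by rewrite mulr_ge0 ?exprn_ge0 ?(ltW x_gt0).
move: rho_x => /eqP; apply; rewrite /critical_density.
have x0 : x != 0 by rewrite gt_eqF.
have rhoE : rho * (k%:R + gap_mean k x) = k%:R.
  have : k%:R * x * (rho / k%:R * ((gap_gf k x)^-1 * (deriv q).[x]) - (1 - rho) * x^-1) = 0.
    by rewrite d0 mulr0.
  move: meanE; move: ((gap_gf k x)^-1 * _) => m -> E.
  apply/eqP; rewrite -subr_eq0 -E; apply/eqP; field.
  by rewrite x0 gt_eqF.
by rewrite -[X in X / _]rhoE mulfK // gt_eqF // ltr_wpDr.
Qed.

(** * Complexity *)

(** Logarithm of the Chernoff bound. In the error term, [ln P(x)] comes from the extra gap and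
    [k |ln x|] from rounding the number of k-mers. *)
Lemma log_count_le (R : realType) k (rho x : R) L :
  (1 < k)%N -> 0 <= rho <= 1 -> 0 < x -> (0 < L)%N ->
  log_count k rho L <=
  Num.max 0 (rate k rho x) + (ln (gap_gf k x) + k%:R * `|ln x|) / L%:R.
Proof.
move=> k_gt1 /andP [rho_ge0 rho_le1] x_gt0 L_gt0.
have k_gt0 := ltnW k_gt1.
have kR : 0 < k%:R :> R by rewrite ltr0n.
have LR : 0 < L%:R :> R by rewrite ltr0n.
have P_gt1 : 1 < gap_gf k x.
  rewrite /gap_gf -(subnKC k_gt1) !big_ord_recl /= expr0 ltrDl ltr_pwDl ?expr1 //.
  by apply: sumr_ge0 => i _; rewrite exprn_ge0 // ltW.
have A_gt0 := ln_gt0 P_gt1.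
have P_gt0 := lt_trans ltr01 P_gt1.
rewrite -[leRHS](mulfK (lt0r_neq0 LR)) /log_count ler_wpM2r ?invr_ge0 ?ler0n //.
rewrite mulrDl divfK ?gt_eqF //.
set M := Num.max 0 _; set t := rho * L%:R / k%:R; set n := Num.truncn t.
have ktE : k%:R * t = rho * L%:R by rewrite /t; field; rewrite gt_eqF.
have t_ge0 : 0 <= t by rewrite divr_ge0 ?mulr_ge0 // ltW.
have /andP [nt tn] := truncn_itv t_ge0; rewrite -/n -[n.+1%:R]natr1 in nt tn.
have M_ge0 : 0 <= M by rewrite le_max lexx.
rewrite num_jammedE //.
(* Without configurations the logarithm is 0 by convention; the maximum with 0 covers this case. *)
have [J0|J_gt0] := posnP (size (jammed_words k n L)).
  by rewrite J0 ln0 // !addr_ge0 ?mulr_ge0 // ltW.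
have JR : 0 < (size (jammed_words k n L))%:R :> R by rewrite ltr0n.
have := size_jammed_words_le R k n L x k_gt0 x_gt0.
rewrite -ler_ln ?posrE ?mulr_gt0 ?exprn_gt0 // !lnM ?posrE ?exprn_gt0 // !lnXn //.
rewrite -![ln x *+ _]mulr_natl -![ln (gap_gf k x) *+ _]mulr_natl natrM -[n.+1%:R]natr1 => up.
have ML : rate k rho x * L%:R <= M * L%:R by rewrite ler_wpM2r ?ler0n // le_max lexx orbT.
have rateE : rate k rho x * L%:R = t * ln (gap_gf k x) - (L%:R - k%:R * t) * ln x.
  by rewrite ktE /rate /t; field; rewrite gt_eqF.
have nA : n%:R * ln (gap_gf k x) <= t * ln (gap_gf k x) by rewrite ler_wpM2r // ltW.
have : k%:R * ((n%:R - t) * ln x) <= k%:R * `|ln x|.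
  rewrite ler_pM2l // (le_trans (ler_norm _)) // normrM ler_piMl //.
  by rewrite ler_norml; lra.
lra.
Qed.

(* If u diverges, its lim is the junk value 0; this is why 0 <= M is required. *)
Lemma lim_le_add_inv (R : realType) (u : nat -> R) (M K : R) : 0 <= M ->
  (forall L, (0 < L)%N -> u L <= M + K / L%:R) -> lim (u L @[L --> \oo]) <= M.
Proof.
move=> M_ge0 uM; have [cu|/dvgP ->//] := pselect (cvg (u L @[L --> \oo])).
apply/ler_addgt0Pr => e e_gt0; apply: limr_le => //.
near=> L; have L_gt0 : (0 < L)%N by near: L; exact: nbhs_infty_gt.
apply: (le_trans (uM L L_gt0)); rewrite lerD2l ler_pdivrMr ?ltr0n //.
rewrite mulrC -ler_pdivrMr //; near: L; exact: nbhs_infty_ger.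
Unshelve. all: by end_near. Qed.

(** The last [s], about [e * L], of the [n + 1] gaps are reserved for adjusting the total; the other
    [N] are controlled by Chebyshev's inequality. *)
Lemma log_count_ge (R : realType) k (x e : R) :
  (1 < k)%N -> critical_weight k x -> 0 < e <= (k%:R + gap_mean k x)^-1 ->
  \forall L \near \oo,
    - ln x - 2 * k%:R * - ln x * e - (2 * k%:R * - ln x + ln 2) / L%:R <=
    log_count k (critical_density k x) L.
Proof.
move=> k_gt1 [/andP [x_gt0 x_lt1] Px] /andP [e_gt0 e_le].
have k_gt0 := ltnW k_gt1.
have kR : 0 < k%:R :> R by rewrite ltr0n.
have P_gt0 := gap_gf_gt0 _ _ _ k_gt0 x_gt0.
have mu_gt0 := gap_mean_gt0 _ _ _ k_gt1 x_gt0.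
have mu_lt := gap_mean_lt _ _ _ k_gt1 x_gt0.
set h := - ln x; set mu := gap_mean k x in e_le mu_gt0 mu_lt *.
have h_gt0 : 0 < h by rewrite oppr_gt0 ln_lt0 // x_gt0.
have lnP : ln (gap_gf k x) = k%:R * h.
  have : ln (x ^+ k * gap_gf k x) = 0 by rewrite Px ln1.
  by rewrite lnM ?posrE ?exprn_gt0 // lnXn // -[ln x *+ _]mulr_natl /h; lra.
(* Distance from the mean to the nearer end of the gap range: [s] gaps can shift the total by
   [c * s] either way. Half of this serves as the deviation [D]; the other half, at least [k],
   absorbs the rounding of [n]. *)
pose c := Num.min mu (k%:R - 1 - mu).
have c_gt0 : 0 < c by rewrite lt_min mu_gt0 subr_gt0.
have [c_mu c_mu'] : c <= mu /\ c <= k%:R - 1 - mu by rewrite !ge_min !lexx orbT.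
near=> L.
have L_gt0 : (0 < L)%N by near: L; exact: nbhs_infty_gt.
have LR : 0 < L%:R :> R by rewrite ltr0n.
have big1 : 2 * k%:R <= c * (e * L%:R).
  rewrite mulrA -ler_pdivrMl ?mulr_gt0 //; near: L; exact: nbhs_infty_ger.
(* Since [N <= L] and [e * L <= s], this gives the Chebyshev condition [2 N k^2 <= D^2] for
   [D = c s / 2]. *)
have big2 : 8 * k%:R ^+ 2 <= (c * e) ^+ 2 * L%:R.
  rewrite -ler_pdivrMl ?exprn_gt0 ?mulr_gt0 //; near: L; exact: nbhs_infty_ger.
pose t := (k%:R + mu)^-1 * L%:R.
have tE : critical_density k x * L%:R / k%:R = t.
  by rewrite /critical_density /t -/mu; field; rewrite !gt_eqF ?addr_gt0.
have LE : L%:R = k%:R * t + mu * t.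
  by rewrite /t; field; rewrite gt_eqF ?addr_gt0.
have t_ge0 : 0 <= t by rewrite mulr_ge0 ?invr_ge0 ?addr_ge0 ?ltW.
have et : e * L%:R <= t by rewrite ler_wpM2r ?ler0n.
have e_ge0 : 0 <= e * L%:R by rewrite mulr_ge0 ?ler0n // ltW.
(* The successor makes [s] exceed [e * L]; the bound on [e] gives [e * L <= t], hence
   [s <= n + 1]. *)
pose n := Num.truncn t; pose s := (Num.truncn (e * L%:R)).+1.
have /andP [nt tn] := truncn_itv t_ge0; rewrite -/n -[n.+1%:R]natr1 in nt tn.
have /andP [se es] := truncn_itv e_ge0; rewrite -/s in es.
have {se} se : s%:R <= e * L%:R + 1 by rewrite /s -natr1 lerD2r.
have sn : (s <= n.+1)%N by rewrite ltnS le_truncn.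
pose N := (n.+1 - s)%N.
have Ns : (N + s)%N = n.+1 by rewrite subnK.
have NR : N%:R = n%:R + 1 - s%:R :> R by rewrite /N natrB // -natr1.
have mut : 0 <= mu * t by rewrite mulr_ge0 // ltW.
have kn_le : k%:R * n%:R <= k%:R * t by rewrite ler_pM2l.
have knL : (k * n <= L)%N by rewrite -(ler_nat R) natrM LE; lra.
pose m := (L - k * n)%N.
have mR : m%:R = k%:R * t + mu * t - k%:R * n%:R by rewrite /m natrB // natrM LE.
have sk : (s * (k - 1))%:R = s%:R * (k%:R - 1) :> R by rewrite natrM natrB.
have s_ge1 : 1 <= s%:R :> R by rewrite ler1n.
have s_ge0 : 0 <= s%:R :> R := ler0n _ _.
have cs : 2 * k%:R <= c * s%:R by apply: (le_trans big1); rewrite ler_pM2l // ltW.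
have D_gt0 : 0 < c * s%:R / 2 by rewrite divr_gt0 // (lt_le_trans _ cs) // mulr_gt0.
have csmu : c * s%:R <= mu * s%:R by rewrite ler_wpM2r.
have csmu' : c * s%:R <= (k%:R - 1 - mu) * s%:R by rewrite ler_wpM2r.
have kt : k%:R * t <= k%:R * (n%:R + 1) by rewrite ler_pM2l // ltW.
have mu_n : mu * n%:R <= mu * t by rewrite ler_pM2l.
have mu_t : mu * t <= mu * (n%:R + 1) by rewrite ler_pM2l // ltW.
have low : gap_gf k x ^+ N / 2 <=
    x ^+ (m - s * (k - 1)) * (size (jammed_words k n L))%:R.
  rewrite size_jammed_wordsE // -Ns.
  rewrite (eq_gap_sum _ _ _ _ (fun j => (j == m)%:R)); last first.
    by move=> j; rewrite -[in RHS](eqn_add2r (k * n)) subnK.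
  apply: gap_sum_pred1_ge D_gt0 _ _ _ => //.
  - by rewrite x_gt0 ltW.
  - have kt_t : t <= k%:R * t by rewrite ler_peMl // ler1n.
    have NL : N%:R <= L%:R :> R by rewrite LE NR; lra.
    have : 2 * N%:R * k%:R ^+ 2 <= 2 * L%:R * k%:R ^+ 2 :> R.
      by rewrite ler_wpM2r ?exprn_ge0 ?ler_wpM2l ?ler0n.
    have : 8 * k%:R ^+ 2 * L%:R <= (c * e) ^+ 2 * L%:R * L%:R by rewrite ler_wpM2r // ltW.
    have : (c * (e * L%:R)) ^+ 2 <= (c * s%:R) ^+ 2.
      by rewrite lerXn2r ?nnegrE ?(mulr_ge0 (ltW c_gt0)) ?ler_pM2l // ltW.
    lra.
  - by rewrite sk mR NR -/mu; lra.
  - by rewrite mR NR -/mu; lra.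
have J_gt0 : 0 < (size (jammed_words k n L))%:R :> R.
  have : 0 < x ^+ (m - s * (k - 1)) * (size (jammed_words k n L))%:R.
    by apply: lt_le_trans low; rewrite divr_gt0 ?exprn_gt0.
  by rewrite pmulr_rgt0 // exprn_gt0.
move: low; rewrite -ler_ln ?posrE ?divr_gt0 ?mulr_gt0 ?exprn_gt0 //.
rewrite ln_div ?posrE ?exprn_gt0 // lnM ?posrE ?exprn_gt0 // !lnXn //.
rewrite -[ln x *+ _]mulr_natl -[ln (gap_gf k x) *+ _]mulr_natl lnP.
have -> : ln x = - h by rewrite opprK.
move=> low.
(* Truncated subtraction can only exceed the real difference. *)
have : h * (m%:R - (s * (k - 1))%:R) <= h * (m - s * (k - 1))%:R.
  by rewrite ler_pM2l // lerBlDr -natrD ler_nat addnC -leq_subLR.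
rewrite sk mR => trunc.
rewrite /log_count tE num_jammedE // -/n -[leLHS](mulfK (lt0r_neq0 LR)).
rewrite ler_wpM2r ?invr_ge0 ?ler0n // mulrBl divfK ?gt_eqF //.
(* Each reserved gap costs [k * h] for the missing factor [P(x)] and [(k - 1) * h] in the exponent
   of [x], in all less than [2 * k * h]. *)
move: low; rewrite NR => low.
have hk : 0 < h * k%:R by rewrite mulr_gt0.
have hs : 0 <= h * s%:R by rewrite mulr_ge0 // ltW.
have : h * k%:R * s%:R <= h * k%:R * (e * L%:R + 1) by rewrite ler_pM2l.
have : h * L%:R = h * (k%:R * t + mu * t) by rewrite -LE.
lra.
Unshelve. all: by end_near. Qed.

Lemma critical_density_itv (R : realType) k (x : R) : (1 < k)%N -> 0 < x ->
  0 <= critical_density k x <= 1.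
Proof.
move=> k_gt1 x_gt0; have mu_gt0 := gap_mean_gt0 _ _ _ k_gt1 x_gt0.
have k_gt0 : 0 < k%:R :> R by rewrite ltr0n ltnW.
rewrite divr_ge0 ?addr_ge0 ?ler0n ?(ltW mu_gt0) //=.
by rewrite ler_pdivrMr ?addr_gt0 // mul1r lerDl ltW.
Qed.

Lemma complexity_critical_density (R : realType) k (x : R) :
  (1 < k)%N -> critical_weight k x -> complexity k (critical_density k x) = - ln x.
Proof.
move=> k_gt1 xc; have [/andP [x_gt0 x_lt1] _] := xc.
have k_gt0 : 0 < k%:R :> R by rewrite ltr0n ltnW.
have mu_gt0 := gap_mean_gt0 _ _ _ k_gt1 x_gt0.
have h_gt0 : 0 < - ln x by rewrite oppr_gt0 ln_lt0 // x_gt0.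
apply: cvg_lim; first exact: Rhausdorff.
apply/cvgrPdist_le => d d_gt0.
(* This makes the loss [2 * k * - ln x * e] at most [d / 2]; the other half of [d] is for the term
   in [1 / L]. *)
pose e := Num.min (k%:R + gap_mean k x)^-1 (d / (4 * k%:R * - ln x)).
have e_gt0 : 0 < e.
  by rewrite lt_min invr_gt0 addr_gt0 // divr_gt0 // !mulr_gt0.
have [e_le e_le'] : e <= (k%:R + gap_mean k x)^-1 /\ e <= d / (4 * k%:R * - ln x).
  by rewrite !ge_min !lexx orbT.
have e_d : 4 * k%:R * - ln x * e <= d by rewrite mulrC -ler_pdivlMr // !mulr_gt0.
have e_itv : 0 < e <= (k%:R + gap_mean k x)^-1 by rewrite e_gt0.
near=> L.
have L_gt0 : (0 < L)%N by near: L; exact: nbhs_infty_gt.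
have LR : 0 < L%:R :> R by rewrite ltr0n.
have up := log_count_le R k _ x L k_gt1 (critical_density_itv _ _ _ k_gt1 x_gt0) x_gt0 L_gt0.
rewrite rate_critical_weight ?(ltnW k_gt1) // max_r ?(ltW h_gt0) // in up.
have low : - ln x - 2 * k%:R * - ln x * e - (2 * k%:R * - ln x + ln 2) / L%:R <=
    log_count k (critical_density k x) L.
  by near: L; exact: log_count_ge.
have K_d : (ln (gap_gf k x) + k%:R * `|ln x|) / L%:R <= d.
  rewrite ler_pdivrMr // -ler_pdivrMl //; near: L; exact: nbhs_infty_ger.
have K'_d : (2 * k%:R * - ln x + ln 2) / L%:R <= d / 2.
  by rewrite ler_pdivrMr // -ler_pdivrMl ?divr_gt0 //; near: L; exact: nbhs_infty_ger.
rewrite ler_norml; lra.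
Unshelve. all: by end_near. Qed.

(** * The maximizing density and its limit *)

Lemma complexity_lt (R : realType) k (rho x : R) :
  (1 < k)%N -> critical_weight k x -> 0 <= rho <= 1 -> rho != critical_density k x ->
  complexity k rho < - ln x.
Proof.
move=> k_gt1 xc rho01 rho_x; have [/andP [x_gt0 x_lt1] _] := xc.
have [y y_gt0] := rate_noncritical _ _ _ _ (ltnW k_gt1) x_gt0 rho_x.
rewrite (rate_critical_weight R k rho x) ?(ltnW k_gt1) // => rate_y.
(* The same [y] serves for all [L], so the gap to [- ln x] survives the limit; the maximum with 0 is
   harmless because [- ln x > 0]. *)
apply: (@le_lt_trans _ _ (Num.max 0 (rate k rho y))).
  apply: (lim_le_add_inv _ _ _ (ln (gap_gf k y) + k%:R * `|ln y|)); first by rewrite le_max lexx.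
  by move=> L L_gt0; exact: log_count_le.
by rewrite gt_max rate_y oppr_gt0 ln_lt0 // x_gt0.
Qed.

Lemma complexity_maximizersE (R : realType) k (x : R) :
  (1 < k)%N -> critical_weight k x ->
  complexity_maximizers R k = [set critical_density k x].
Proof.
move=> k_gt1 xc; have [/andP [x_gt0 _] _] := xc.
have c01 := critical_density_itv _ _ _ k_gt1 x_gt0.
apply/seteqP; split=> [rho [rho01 rho_max]|_ ->] /=.
  apply/eqP/negPn/negP => rho_x.
  have := complexity_lt _ _ _ _ k_gt1 xc rho01 rho_x.
  by rewrite ltNge -(complexity_critical_density _ _ _ k_gt1 xc) rho_max.
split=> // r r01; have [->//|r_x] := eqVneq r (critical_density k x).
by rewrite (complexity_critical_density _ _ _ k_gt1 xc) ltW // complexity_lt.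
Qed.

Lemma rho_starE (R : realType) k (x : R) :
  (1 < k)%N -> critical_weight k x -> rho_star R k = critical_density k x.
Proof.
move=> k_gt1 xc; have maxE := complexity_maximizersE _ _ _ k_gt1 xc.
have : complexity_maximizers R k (rho_star R k).
  by apply: getPex; exists (critical_density k x); rewrite maxE.
by rewrite maxE.
Qed.

(** With [mu] the mean gap, [1 - k / (k + mu) <= mu / k], and
    [ln k * mu <= 4 k (1 - x) mu <= 4 k]. *)
Lemma critical_density_ge (R : realType) k (x : R) :
  (1 < k)%N -> critical_weight k x -> 1 - 4 / ln k%:R <= critical_density k x.
Proof.
move=> k_gt1 xc; have [x01 _] := xc; have /andP [x_gt0 x_lt1] := x01.
have k_gt0 : 0 < k%:R :> R by rewrite ltr0n ltnW.
have lnk_gt0 : 0 < ln k%:R :> R by rewrite ln_gt0 // ltr1n.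
have mu_gt0 := gap_mean_gt0 _ _ _ k_gt1 x_gt0.
have ln_le := ln_le_critical_weight _ _ _ k_gt1 xc.
have mu_le : (1 - x) * gap_mean k x <= 1.
  by rewrite mulrC -ler_pdivlMr ?subr_gt0 // mul1r gap_mean_le // ltnW.
have : ln k%:R * gap_mean k x <= 4 * k%:R.
  have : ln k%:R * gap_mean k x <= 4 * (k%:R * (1 - x)) * gap_mean k x by rewrite ler_pM2r.
  have : 4 * k%:R * ((1 - x) * gap_mean k x) <= 4 * k%:R * 1 by rewrite ler_pM2l // mulr_gt0.
  lra.
rewrite -ler_pdivlMl // => mu_le4.
rewrite ler_pdivlMr ?addr_gt0 // mulrBl mul1r lerBlDr lerD2l.
rewrite (le_trans mu_le4) // mulrA [_^-1 * 4]mulrC ler_pM2l ?divr_gt0 // lerDl ltW //.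
Qed.

(** Uniqueness of the maximizer accompanies the limit, so that the choice made by [get] is forced
    for every [k >= 2]. *)
Theorem theorem4p2 (R : realType) :
  (forall k : nat, (2 <= k)%N ->
     complexity_maximizers R k = [set rho_star R k]) /\
  rho_star R k @[k --> \oo] --> (1 : R).
Proof.
split=> [k k_gt1|].
  have [x xc] := exists_critical_weight R k k_gt1.
  by rewrite (rho_starE _ _ _ k_gt1 xc) (complexity_maximizersE _ _ _ k_gt1 xc).
apply/cvgrPdist_le => e e_gt0; near=> k.
have k_gt1 : (1 < k)%N by near: k; exact: nbhs_infty_gt.
have [x xc] := exists_critical_weight R k k_gt1.
have [/andP [x_gt0 _] _] := xc.
have /andP [_ rho_le1] := critical_density_itv _ _ _ k_gt1 x_gt0.
have rho_ge := critical_density_ge _ _ _ k_gt1 xc.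
rewrite (rho_starE _ _ _ k_gt1 xc) ger0_norm ?subr_ge0 //.
(* Holds once [k] exceeds the exponential of [4 / e]. *)
have ln_ge : 4 / e <= ln k%:R.
  rewrite -[4 / e]expRK ler_ln ?posrE ?expR_gt0 ?ltr0n ?(ltnW k_gt1) //.
  by near: k; exact: nbhs_infty_ger.
have : 4 / ln k%:R <= e.
  rewrite ler_pdivrMr; last by rewrite (lt_le_trans _ ln_ge) // divr_gt0.
  by rewrite -ler_pdivrMl // mulrC.
lra.
Unshelve. all: by end_near. Qed.
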